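(* For $n\ge1$ let $N_n(t,q,r)=\sum_{\sigma\in\mathfrak{S}_n(321)}t^{\mathsf{exc}\,\sigma}q^{\mathsf{inv}\,\sigma}r^{\mathsf{fix}\,\sigma}$. Then for each of the five quadruples $(\tau,\mathsf{stat}_1,\mathsf{stat}_2,\mathsf{stat}_3)\in\{(321,\mathsf{exc},\mathsf{inv},\mathsf{fix}),\ (231,\mathsf{des},\mathsf{des}+(31\text{-}2),\mathsf{fmax}),\ (132,\mathsf{asc},\mathsf{asc}+(2\text{-}13),\mathsf{amax}),\ (312,\mathsf{des},\mathsf{des}+(2\text{-}31),\mathsf{amin}),\ (213,\mathsf{asc},\mathsf{asc}+(13\text{-}2),\mathsf{fmin})\}$ we have $$N_{n}(t/q, q, 1)=\sum_{\sigma\in\mathfrak{S}_{n-1}(\tau)}t^{\mathsf{stat}_1\sigma}q^{\mathsf{stat}_2\sigma}(1+t)^{\mathsf{stat}_3\sigma},$$ $$N_{n}(t, q, t)=t^n\sum_{\sigma\in\mathfrak{S}_{n-1}(\tau)}(q/t)^{\mathsf{stat}_1\sigma}q^{\mathsf{stat}_2\sigma}(1+q/t)^{\mathsf{stat}_3\sigma}.$$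
   Context: $\mathfrak{S}_m(\tau)$ is the set of permutations of $[m]$ avoiding the classical pattern $\tau$ ($\mathfrak{S}_0$ consists of the empty permutation). For $\sigma\in\mathfrak{S}_m$: $\mathsf{exc}\,\sigma=\#\{i:\sigma(i)>i\}$, $\mathsf{fix}\,\sigma=\#\{i:\sigma(i)=i\}$, $\mathsf{inv}$ is the number of inversions, $\mathsf{des}\,\sigma=\#\{i\in[m-1]:\sigma(i)>\sigma(i+1)\}$, $\mathsf{asc}\,\sigma=\#\{i\in[m-1]:\sigma(i)<\sigma(i+1)\}$. Vincular pattern counts: $(31\text{-}2)\sigma=\#\{(i,j):i+1<j\le m,\ \sigma(i+1)<\sigma(j)<\sigma(i)\}$, $(2\text{-}31)\sigma=\#\{(i,j):j<i<m,\ \sigma(i+1)<\sigma(j)<\sigma(i)\}$, $(2\text{-}13)\sigma=\#\{(i,j):j<i<m,\ \sigma(i)<\sigma(j)<\sigma(i+1)\}$, $(13\text{-}2)\sigma=\#\{(i,j):i+1<j\le m,\ \sigma(i)<\sigma(j)<\sigma(i+1)\}$. With the convention $\sigma(0)=0,\sigma(m+1)=\infty$, a value $\sigma(i)$ ($1\le i\le m$) is a double ascent if $\sigma(i-1)<\sigma(i)<\sigma(i+1)$; $\mathsf{fmax}\,\sigma$ (resp. $\mathsf{amin}\,\sigma$) is the number of such double ascents that are also left-to-right maxima (resp. right-to-left minima). With the convention $\sigma(0)=\infty,\sigma(m+1)=0$, $\sigma(i)$ is a double descent if $\sigma(i-1)>\sigma(i)>\sigma(i+1)$; $\mathsf{amax}\,\sigma$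 (resp. $\mathsf{fmin}\,\sigma$) is the number of such double descents that are also right-to-left maxima (resp. left-to-right minima). *)

(* Defs.v *)
From HB Require Import structures.
From mathcomp Require Import all_boot all_order all_algebra all_fingroup.
Set Implicit Arguments. Unset Strict Implicit. Unset Printing Implicit Defensive.
Import GRing.Theory.

(* Permutations of [m] are elements of 'S_m = {perm 'I_m}.  Positions and
   values are 0-based: position a (0 <= a < m) stands for position a+1 and
   value v for value v+1 in the paper; all statistics below are invariant
   under this shift. *)

Definition sv (m : nat) (s : 'S_m) (a : nat) : nat :=
  nth 0 [seq val (s j) | j <- enum 'I_m] a.

Definition contains3 (tau : seq nat) (m : nat) (s : 'S_m) : bool :=
  let a := nth 0 tau 0 in let b := nth 0 tau 1 in let c := nth 0 tau 2 in
  [exists i : 'I_m, exists j : 'I_m, exists k : 'I_m,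
     [&& i < j, j < k,
         (s i < s j) == (a < b), (s i < s k) == (a < c) & (s j < s k) == (b < c)]].
Definition avoids (tau : seq nat) (m : nat) (s : 'S_m) : bool := ~~ contains3 tau s.

Definition exc (m : nat) (s : 'S_m) : nat := \sum_(0 <= a < m) (a < sv s a : nat).
Definition fixp (m : nat) (s : 'S_m) : nat := \sum_(0 <= a < m) (sv s a == a : nat).
Definition inv (m : nat) (s : 'S_m) : nat :=
  \sum_(0 <= a < m) \sum_(a.+1 <= b < m) (sv s b < sv s a : nat).
Definition des (m : nat) (s : 'S_m) : nat :=
  \sum_(0 <= a < m.-1) (sv s a.+1 < sv s a : nat).
Definition asc (m : nat) (s : 'S_m) : nat :=
  \sum_(0 <= a < m.-1) (sv s a < sv s a.+1 : nat).

Definition p31_2 (m : nat) (s : 'S_m) : nat :=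
  \sum_(0 <= a < m) \sum_(a.+2 <= b < m)
     ((sv s a.+1 < sv s b) && (sv s b < sv s a) : nat).
Definition p2_31 (m : nat) (s : 'S_m) : nat :=
  \sum_(0 <= a < m.-1) \sum_(0 <= b < a)
     ((sv s a.+1 < sv s b) && (sv s b < sv s a) : nat).
Definition p2_13 (m : nat) (s : 'S_m) : nat :=
  \sum_(0 <= a < m.-1) \sum_(0 <= b < a)
     ((sv s a < sv s b) && (sv s b < sv s a.+1) : nat).
Definition p13_2 (m : nat) (s : 'S_m) : nat :=
  \sum_(0 <= a < m) \sum_(a.+2 <= b < m)
     ((sv s a < sv s b) && (sv s b < sv s a.+1) : nat).

(* double ascent, with s(0) = 0 and s(m+1) = infinity *)
Definition dasc (m : nat) (s : 'S_m) (a : nat) : bool :=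
  ((a == 0) || (sv s a.-1 < sv s a)) && ((a == m.-1) || (sv s a < sv s a.+1)).
(* double descent, with s(0) = infinity and s(m+1) = 0 *)
Definition ddes (m : nat) (s : 'S_m) (a : nat) : bool :=
  ((a == 0) || (sv s a < sv s a.-1)) && ((a == m.-1) || (sv s a.+1 < sv s a)).

Definition ltr_max (m : nat) (s : 'S_m) (a : nat) : bool :=
  [forall b : 'I_m, (b < a) ==> (sv s b < sv s a)].
Definition ltr_min (m : nat) (s : 'S_m) (a : nat) : bool :=
  [forall b : 'I_m, (b < a) ==> (sv s a < sv s b)].
Definition rtl_max (m : nat) (s : 'S_m) (a : nat) : bool :=
  [forall b : 'I_m, (a < b) ==> (sv s b < sv s a)].
Definition rtl_min (m : nat) (s : 'S_m) (a : nat) : bool :=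
  [forall b : 'I_m, (a < b) ==> (sv s a < sv s b)].

Definition fmax (m : nat) (s : 'S_m) : nat :=
  \sum_(0 <= a < m) (dasc s a && ltr_max s a : nat).
Definition amin (m : nat) (s : 'S_m) : nat :=
  \sum_(0 <= a < m) (dasc s a && rtl_min s a : nat).
Definition amax (m : nat) (s : 'S_m) : nat :=
  \sum_(0 <= a < m) (ddes s a && rtl_max s a : nat).
Definition fmin (m : nat) (s : 'S_m) : nat :=
  \sum_(0 <= a < m) (ddes s a && ltr_min s a : nat).

Definition statistic := forall m : nat, 'S_m -> nat.

Inductive quadruple : seq nat -> statistic -> statistic -> statistic -> Prop :=
| Q321 : quadruple [:: 3; 2; 1] exc inv fixp
| Q231 : quadruple [:: 2; 3; 1] des (fun m s => des s + p31_2 s) fmax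
| Q132 : quadruple [:: 1; 3; 2] asc (fun m s => asc s + p2_13 s) amax
| Q312 : quadruple [:: 3; 1; 2] des (fun m s => des s + p2_31 s) amin
| Q213 : quadruple [:: 2; 1; 3] asc (fun m s => asc s + p13_2 s) fmin.

Local Open Scope ring_scope.
Definition Npoly (R : fieldType) (n : nat) (t q r : R) : R :=
  \sum_(s : 'S_n | avoids [:: 3; 2; 1] s) t ^+ exc s * q ^+ inv s * r ^+ fixp s.

(* Main.v *)
Require Import Defs.
From mathcomp Require Import all_boot all_order all_algebra all_fingroup.
From mathcomp Require Import ring zify.
Set Implicit Arguments. Unset Strict Implicit. Unset Printing Implicit Defensive.
Import GRing.Theory.

(* All five generating functions equal the same weighted count of Motzkin paths
   (a Jacobi continued fraction).  For 321, the position h and the value h are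
   deleted from permutations whose first h positions are all sent above h, which
   gives the path recurrence directly.  For 231, splitting a permutation at its
   first letter gives convolution recurrences, matched with the paths by a
   first-passage decomposition; reversal and complement then yield 132, 312 and
   213.  The two identities compare the even and odd contractions of a Stieltjes
   continued fraction, which on paths is an induction on the length. *)

(** * Weighted Motzkin paths *)

(** The parameter [r] marks level steps at height 0, and the three statistics have the same joint
    distribution in all five cases. So [tau] disappears, and both claims compare [n] steps with
    [r = 1] or [r = t] to [n - 1] steps with [r = 1 + t] or [r = 1 + q/t]. At height 0 alone neither
    comparison is closed under induction, hence the arbitrary starting height [h]. For 231 the
    obstacle is that the number of 31-2 patterns using the first letter [a] depends on the letter
    after [a]. The block below [a] therefore needs a second generating function, [headed231], that
    remembers its first letter. It turns out to be a path sum with [r = 1 + t]. This matches an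
    excursion above height 0: lowered by one height, its level steps at height 1 become level steps
    at height 0 of weight [1 + t], up to powers of [q]. *)

Section MotzkinSums.
Local Open Scope ring_scope.
Variable R : comNzRingType.
Implicit Types t q r : R.

(* Weighted Motzkin paths of n steps from height h down to 0: an up step weighs
   t, a step down from h weighs q^(2h-1), a level step weighs r at height 0 and
   (1+t) q^h at height h > 0. *)
Fixpoint motzkin t q r (n h : nat) : R :=
  if n is n'.+1 then
    if h is h'.+1 then
      (1 + t) * q ^+ h * motzkin t q r n' h + t * motzkin t q r n' h.+1
      + q ^+ (h'.*2).+1 * motzkin t q r n' h'
    else r * motzkin t q r n' 0 + t * motzkin t q r n' 1
  else (h == 0%N)%:R.

(** Cut the path where it first reaches 0. Lowering the [i] earlier steps by one height takes [q]
    off each level step and [q^2] off each down step. Downs exceed ups by [h], so this amounts to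
    [q^(i + h)]; the step from 1 to 0 gives one more [q]. *)
Lemma motzkin_first_passage t q r n h :
  motzkin t q r n h.+1 =
  \sum_(i < n) q ^+ (i + h).+1 * motzkin t q (1 + t) i h
               * motzkin t q r (n.-1 - i) 0.
Proof.
elim: n h => [|n IHn] h; first by rewrite big_ord0.
rewrite big_ord_recl /= subn0 add0n.
(* The terms [i > 0] are the paths whose first step does not reach 0. The coefficient [(h != 0)]
   drops the first down step when [h = 0], as that path is the term [i = 0]. *)
have -> : \sum_(i < n) q ^+ (bump 0 i + h).+1 *
      motzkin t q (1 + t) (bump 0 i) h * motzkin t q r (n - bump 0 i) 0
  = (1 + t) * q ^+ h.+1 * motzkin t q r n h.+1 + t * motzkin t q r n h.+2
    + (h != 0%N)%:R * q ^+ (h.*2).+1 * motzkin t q r n h.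
  rewrite !IHn !mulr_sumr -!big_split /=.
  case: h => [|h] /=.
    rewrite !mul0r addr0; apply: eq_bigr => i _ /=.
    rewrite /bump /= !add1n !addn0 addn1 expr1 (_ : (n - i.+1)%N = (n.-1 - i)%N); last by lia.
    by rewrite !exprS; ring.
  rewrite IHn !mul1r mulr_sumr -!big_split; apply: eq_bigr => i _ /=.
  rewrite /bump /= !add1n (_ : (n - i.+1)%N = (n.-1 - i)%N); last by lia.
  by rewrite -!addnn !addnS !addSn !exprS !exprD; ring.
case: h => [|h] /=; first by rewrite !expr1; ring.
by ring.
Qed.

(** Write [r' = r + (r' - r)] on each level step at height 0 and cut at the last step where [r' - r]
    is chosen: steps before it still weigh [r'], steps after it weigh [r]. *)
Lemma motzkin_change_r t q r r' n h :
  motzkin t q r' n h =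
  motzkin t q r n h +
  (r' - r) * \sum_(i < n) motzkin t q r' i h * motzkin t q r (n.-1 - i) 0.
Proof.
elim: n h => [|n IHn] h; first by rewrite big_ord0 mulr0 addr0.
rewrite big_ord_recl subn0.
have E (i : 'I_n) : (n.+1.-1 - lift ord0 i)%N = (n.-1 - i)%N by rewrite lift0 /=; lia.
under eq_bigr => i _ do rewrite E lift0.
case: h => [|h] /=.
  rewrite mul1r !(IHn 0%N) !(IHn 1%N) /=.
  under [X in _ = _ + _ * (_ + X)]eq_bigr => i _ do rewrite mulrDl -!mulrA.
  by rewrite big_split -!mulr_sumr /=; ring.
rewrite mul0r add0r !(IHn h) !(IHn h.+1) !(IHn h.+2).
under [X in _ = _ + _ * X]eq_bigr => i _ do rewrite !mulrDl -!mulrA.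
by rewrite !big_split -!mulr_sumr /=; ring.
Qed.

Lemma motzkin0_recl t q r n :
  motzkin t q r n.+1 0 = r * motzkin t q r n 0 +
  \sum_(i < n) t * q ^+ i.+1 * motzkin t q (1 + t) i 0 * motzkin t q r (n.-1 - i) 0.
Proof.
rewrite /= motzkin_first_passage mulr_sumr; congr (_ + _).
by apply: eq_bigr => i _; rewrite addn0; ring.
Qed.

End MotzkinSums.

(** * Contraction identities for path sums *)

Section Contraction.
Local Open Scope ring_scope.
Variable R : fieldType.
Implicit Types t q : R.

(* The two continued fractions in each contraction lemma are the even and the
   odd contraction of one Stieltjes fraction, with coefficients 1, t, q, tq,
   q^2, tq^2, ... here and t, q, tq, q^2, tq^2, ... in the next lemma. *)
Lemma motzkin_contraction1 t q n h : q != 0 ->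
  motzkin (t / q) q 1 n.+1 h =
  q ^+ h * motzkin t q (1 + t) n h +
  (if h is h'.+1 then q ^+ (h'.*2).+1 * motzkin t q (1 + t) n h' else 0).
Proof.
move=> q0; elim: n h => [|n IHn] h.
  case: h => [|[|h]] /=; rewrite -?addnn /= ?addnS ?expr0 ?expr1 ?exprS; ring.
(* Unfolds one step only: [/=] would also unfold the sums of length [n.+1], to which the induction
   hypothesis must apply. *)
have -> m k: motzkin (t / q) q 1 m.+1 k = if k is k'.+1 then
      (1 + t / q) * q ^+ k * motzkin (t / q) q 1 m k + t / q * motzkin (t / q) q 1 m k.+1
      + q ^+ (k'.*2).+1 * motzkin (t / q) q 1 m k'
    else 1 * motzkin (t / q) q 1 m 0 + t / q * motzkin (t / q) q 1 m 1 by [].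
case: h => [|[|h]]; rewrite !IHn /= -?addnn ?addSn ?addnS ?addn0 ?exprS ?expr0 ?exprD; field => //.
Qed.

Lemma motzkin_contraction2 t q n h : t != 0 ->
  t ^+ h * motzkin t q t n.+1 h =
  t ^+ n.+1 * (q ^+ h * motzkin (q / t) q (1 + q / t) n h +
  (if h is h'.+1 then q ^+ (h'.*2).+1 * motzkin (q / t) q (1 + q / t) n h' else 0)).
Proof.
(* Dividing each of the [n.+1] steps by [t] leaves weight [1/t] on down steps, and [t ^+ h] moves it
   to the up steps. The left side is thus [t ^+ n.+1] times the path sum with parameters [1/t], [q],
   [1], that is, the previous lemma with [q / t] for [t]. *)
move=> t0; elim: n h => [|n IHn] h.
  case: h => [|[|h]] /=; rewrite -?addnn /= ?addnS ?expr0 ?expr1 ?exprS; ring.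
have IH k : motzkin t q t n.+1 k =
  (t ^+ k)^-1 * (t ^+ n.+1 * (q ^+ k * motzkin (q / t) q (1 + q / t) n k +
  (if k is k'.+1 then q ^+ (k'.*2).+1 * motzkin (q / t) q (1 + q / t) n k' else 0))).
  by rewrite -IHn mulKf // expf_neq0.
have -> m k: motzkin t q t m.+1 k = if k is k'.+1 then
      (1 + t) * q ^+ k * motzkin t q t m k + t * motzkin t q t m k.+1
      + q ^+ (k'.*2).+1 * motzkin t q t m k'
    else t * motzkin t q t m 0 + t * motzkin t q t m 1 by [].
have tk k : t ^+ k != 0 by rewrite expf_neq0.
case: h => [|[|h]]; rewrite !IH /= -?addnn ?addSn ?addnS ?addn0 ?exprS ?expr0 ?exprD; field;
  rewrite ?t0 ?tk ?oner_neq0 //.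
Qed.

End Contraction.

(** * 321-avoiding permutations *)

Lemma sv_ord m (s : 'S_m) (i : 'I_m) : sv s i = s i.
Proof. by rewrite /sv (nth_map i) ?size_enum_ord // nth_ord_enum. Qed.

Lemma excE m (s : 'S_m) : exc s = \sum_(i < m) (i < s i).
Proof. by rewrite /exc big_mkord; apply: eq_bigr => i _; rewrite sv_ord. Qed.

Lemma fixpE m (s : 'S_m) : fixp s = \sum_(i < m) (s i == i).
Proof. by rewrite /fixp big_mkord; apply: eq_bigr => i _; rewrite sv_ord. Qed.

Lemma invE m (s : 'S_m) : Defs.inv s = \sum_(i < m) \sum_(j < m) ((i < j) && (s j < s i)).
Proof.
rewrite /Defs.inv big_mkord; apply: eq_bigr => i _.
rewrite big_geq_mkord big_mkcond; apply: eq_bigr => j _ /=.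
by rewrite !sv_ord; case: ltnP.
Qed.

Lemma avoids321P m (s : 'S_m) :
  reflect (forall i j k : 'I_m, i < j -> j < k -> s k < s j -> s j < s i -> False)
          (avoids [:: 3; 2; 1] s).
Proof.
rewrite /avoids /contains3 /=; apply: (iffP idP) => [avs i j k ij jk kj ji | avs].
  move/negP: avs; apply; apply/existsP; exists i; apply/existsP; exists j.
  by apply/existsP; exists k; lia.
apply/negP => /existsP[i /existsP[j /existsP[k /and5P[ij jk]]]].
rewrite !eqbF_neg -!leqNgt => ji ki kj; apply: (avs i j k) => //.
  have : s j != s k by apply: contraTneq jk => /perm_inj->; rewrite ltnn.
  by rewrite -val_eqE /=; lia.
have : s i != s j by apply: contraTneq ij => /perm_inj->; rewrite ltnn.
by rewrite -val_eqE /=; lia.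
Qed.

Lemma big_lift_perm (R : nmodType) m (i j : 'I_m.+1) (P : pred 'S_m.+1) (F : 'S_m.+1 -> R) :
  (\sum_(s | P s && (s i == j)) F s =
   \sum_(s | P (lift_perm i j s)) F (lift_perm i j s))%R.
Proof.
rewrite (reindex (lift_perm i j)); last first.
  (* [f s] is [s] with the point at [i] deleted and the rest standardised; injectivity of [s] keeps
     the default [k] from being reached. *)
  pose f (s : 'S_m.+1) k := odflt k (unlift (s i) (s (lift i k))).
  have fE (s : 'S_m.+1) k : lift (s i) (f s k) = s (lift i k).
    rewrite /f; case: unliftP => [k' -> // | /perm_inj/eqP].
    by rewrite lift_eqF.
  have f_inj (s : 'S_m.+1) : injective (f s).
    by move=> k k' e; have := fE s k; rewrite e fE => /perm_inj/lift_inj.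
  exists (fun s => perm (f_inj s)) => [s _ | s].
    by apply/permP=> k; rewrite permE /f lift_perm_lift lift_perm_id liftK.
  move=> /andP[_ /eqP si]; apply/permP=> k.
  case: (unliftP i k) => [k'|] ->; rewrite ?lift_perm_id //.
  by rewrite lift_perm_lift -si permE fE.
by apply: eq_bigl => s; rewrite lift_perm_id eqxx andbT.
Qed.

Lemma sum_ord_lt m h : h <= m -> \sum_(k < m) (k < h : nat) = h.
Proof.
move=> hm; transitivity (\sum_(k < m | k < h) 1).
  by rewrite [RHS]big_mkcond; apply: eq_bigr => k _; case: ltnP.
by rewrite -(big_ord_widen m (fun=> 1)) // sum_nat_const card_ord muln1.
Qed.

Lemma sum_perm_lt m (s : 'S_m) h : h <= m -> \sum_(k < m) (s k < h : nat) = h.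
Proof. by move=> hm; rewrite -[RHS](sum_ord_lt hm) [RHS](reindex_perm s). Qed.

Lemma inv_lift_perm m (i j : 'I_m.+1) (s : 'S_m) :
  Defs.inv (lift_perm i j s) = Defs.inv s +
    (\sum_(k < m) ((i <= k) && (s k < j)) + \sum_(k < m) ((k < i) && (j <= s k))).
Proof.
rewrite !invE (bigD1_ord i) //= (bigD1_ord i) //= ltnn add0n.
rewrite addnCA; congr (_ + _).
  apply: eq_bigr => k _; rewrite lift_perm_id lift_perm_lift /= /bump; lia.
rewrite -big_split /=; apply: eq_bigr => k _.
rewrite (bigD1_ord i) //= addnC; congr (_ + _).
  apply: eq_bigr => l _; rewrite !lift_perm_lift /= /bump; lia.
rewrite lift_perm_id lift_perm_lift /= /bump; lia.
Qed.

Lemma inv_lift_perm0l m (j : 'I_m.+1) (s : 'S_m) :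
  Defs.inv (lift_perm ord0 j s) = Defs.inv s + j.
Proof.
rewrite inv_lift_perm /=; congr (_ + _); rewrite [X in _ + X = _]big1 // addn0.
by rewrite sum_perm_lt // -ltnS.
Qed.

Lemma inv_lift_perm0r m (i : 'I_m.+1) (s : 'S_m) :
  Defs.inv (lift_perm i ord0 s) = Defs.inv s + i.
Proof.
rewrite inv_lift_perm /=; congr (_ + _).
rewrite [X in X + _ = _]big1 => [|k _]; last by rewrite andbF.
by under eq_bigr do rewrite andbT; rewrite sum_ord_lt // -ltnS.
Qed.

(** This encodes height [h] of a path: none of the first [h] positions is matched with one of the
    first [h] values, so both families are still open. *)
Definition sends_above m (s : 'S_m) (h : nat) : bool :=
  [forall i : 'I_m, (i < h) ==> (h <= s i)].

Lemma sends_aboveP m (s : 'S_m) h :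
  reflect (forall i : 'I_m, i < h -> h <= s i) (sends_above s h).
Proof.
by apply: (iffP forallP) => H i; [move/implyP: (H i) | apply/implyP/H].
Qed.

Lemma avoids321_lift_perm m (i j : 'I_m.+1) (s : 'S_m) :
  avoids [:: 3; 2; 1] (lift_perm i j s) -> avoids [:: 3; 2; 1] s.
Proof.
move=> /avoids321P avs; apply/avoids321P => a b c ab bc cb ba.
apply: (avs (lift i a) (lift i b) (lift i c)); rewrite ?lift_perm_lift /= /bump; lia.
Qed.

(** A new 321 would start at the inserted point and use two values below [h], so [h >= 2]. Then the
    old first entry is at least [h] and could replace the inserted point. *)
Lemma avoids321_lift_perm0l m (h : 'I_m.+1) (s : 'S_m) :
  (forall k : 'I_m, k < h.-1 -> h <= s k) ->
  avoids [:: 3; 2; 1] s -> avoids [:: 3; 2; 1] (lift_perm ord0 h s).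
Proof.
move=> sh /avoids321P avs; apply/avoids321P => a b c.
case: (unliftP ord0 b) => [{}b ->|->]; last by rewrite ltn0.
case: (unliftP ord0 c) => [{}c ->|->]; last by rewrite ltn0.
case: (unliftP ord0 a) => [{}a ->|->]; rewrite ?lift_perm_id !lift_perm_lift /= /bump.
  by move=> ab bc cb ba; apply: (avs a b c); lia.
move=> _ bc cb bh; have m0 : 0 < m by apply: leq_trans (ltn_ord b).
have h1 : 0 < h.-1 by lia.
have /= z_h := sh (Ordinal m0) h1.
have b0 : b != Ordinal m0 by apply/eqP=> eb; move: bh; rewrite eb; lia.
by move: b0; rewrite -val_eqE /= => b0; apply: (avs (Ordinal m0) b c) => /=; lia.
Qed.

(** A new 321 would end at the inserted point; the old value 0, which sits at position [h] or later,
    could replace it. *)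
Lemma avoids321_lift_perm0r m (h : 'I_m.+1) (s : 'S_m) :
  (forall k : 'I_m, k < h -> 0 < s k) ->
  avoids [:: 3; 2; 1] s -> avoids [:: 3; 2; 1] (lift_perm h ord0 s).
Proof.
move=> sh /avoids321P avs; apply/avoids321P => a b c.
case: (unliftP h a) => [{}a ->|->]; last by rewrite !lift_perm_id ltn0.
case: (unliftP h b) => [{}b ->|->]; last by rewrite lift_perm_id ltn0.
case: (unliftP h c) => [{}c ->|->]; rewrite ?lift_perm_id !lift_perm_lift /= /bump.
  by move=> ab bc cb ba; apply: (avs a b c); lia.
move=> ab bh _ ba; have m0 : 0 < m by apply: leq_trans (ltn_ord b).
pose z : 'I_m := (s^-1)%g (Ordinal m0); have sc : s z = Ordinal m0 by rewrite permKV.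
have hc : h <= z by rewrite leqNgt; apply/negP=> /sh; rewrite sc.
by apply: (avs a b z); rewrite ?sc /=; have := sh b; lia.
Qed.

(** The value 0 lies at position [h] or later, so it would complete a descending pair of positive
    values among the positions up to [h] to a 321. *)
Lemma sends_above_monotone m (s : 'S_m) h (i j : 'I_m) : 0 < h ->
  avoids [:: 3; 2; 1] s -> sends_above s h -> i < j -> j <= h -> 0 < s j -> s i < s j.
Proof.
move=> h0 /avoids321P avs /sends_aboveP sh ij jh sj; rewrite ltnNge; apply/negP => ji.
have {}ji : s j < s i.
  by rewrite ltn_neqAle ji andbT; apply: contraTneq ij => /val_inj/perm_inj->; rewrite ltnn.
have m0 : 0 < m by apply: leq_trans (ltn_ord i).
pose z : 'I_m := (s^-1)%g (Ordinal m0); have sc : s z = Ordinal m0 by rewrite permKV.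
have hc : h <= z by rewrite leqNgt; apply/negP=> /sh; rewrite sc /=; lia.
have jc : j != z by apply: contraTneq sj => ->; rewrite sc.
by move: jc; rewrite -val_eqE /= => jc; apply: (avs i j z) => //; rewrite ?sc /=; lia.
Qed.

(* A 321-avoiding permutation sending [0, h) above h either sends [0, h] above
   h + 1, or has s 0 = h or s h = 0 (or both); in the latter cases these points
   are deleted. *)
Lemma sends_above_enter m (h : 'I_m.+1) (s : 'S_m) : 0 < h ->
  let s' := lift_perm ord0 h s in
  [&& avoids [:: 3; 2; 1] s', sends_above s' h & s' h != ord0]
    = avoids [:: 3; 2; 1] s && sends_above s h.
Proof.
move=> h0 s'; apply/and3P/andP => [[avs sh hs]|[avs /sends_aboveP sh]]; split.
- exact: avoids321_lift_perm avs.
- have s'0 : s' ord0 = h by rewrite lift_perm_id.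
  apply/sends_aboveP => k kh.
  have := @sends_above_monotone _ s' h ord0 (lift ord0 k) h0 avs sh isT kh.
  rewrite s'0 lift_perm_lift /= /bump => mono.
  have [h1|h1] := eqVneq k.+1 h; last first.
    by have /sends_aboveP/(_ (lift ord0 k)) := sh; rewrite lift_perm_lift /= /bump; lia.
  (* The sum is the value of [s'] at position [h], the one position where monotonicity and the
     hypothesis [s' h != ord0] are needed. *)
  suff : 0 < (h <= s k) + s k by move/mono; lia.
  move: hs; rewrite (_ : h = lift ord0 k) ?lift_perm_lift -?val_eqE //=.
    by rewrite /bump; lia.
  by apply: val_inj => /=; rewrite /bump; lia.
- by apply: avoids321_lift_perm0l => // k kh; apply: sh; lia.
- apply/sends_aboveP => k; case: (unliftP ord0 k) => [{}k ->|->]; rewrite ?lift_perm_id //.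
  by rewrite lift_perm_lift /= /bump => kh; have := sh k; lia.
- case: (unliftP ord0 h) => [k hk|e]; last by move: h0; rewrite e.
  have hk' : h = k.+1 :> nat by rewrite hk.
  have hsk : h <= s k by apply: sh; rewrite hk'.
  by have := lift_perm_lift ord0 h s k; rewrite -hk => ->; rewrite -val_eqE /= /bump hsk.
Qed.

Lemma sends_above_leave m (h : 'I_m.+1) (s : 'S_m) : 0 < h ->
  let s' := lift_perm h ord0 s in
  [&& avoids [:: 3; 2; 1] s', sends_above s' h & s' ord0 != h]
    = avoids [:: 3; 2; 1] s && sends_above s h.
Proof.
move=> h0 s'; have lift0h (k : 'I_m) : k = 0 :> nat -> lift h k = ord0.
  by move=> k0; apply: val_inj; rewrite /= /bump k0; lia.
apply/and3P/andP => [[avs sh hs]|[avs /sends_aboveP sh]]; split.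
- exact: avoids321_lift_perm avs.
- apply/sends_aboveP => k kh.
  have m0 : 0 < m by apply: leq_trans (ltn_ord k).
  pose z : 'I_m := Ordinal m0.
  have /sends_aboveP/(_ ord0 h0) := sh.
  have := @sends_above_monotone _ s' h ord0 (lift h k) h0 avs sh.
  move: hs; rewrite -(lift0h z) // !lift_perm_lift -val_eqE /= /bump.
  have [->|] := eqVneq k z; first by lia.
  by rewrite -val_eqE /=; lia.
- by apply: avoids321_lift_perm0r => // k kh; have := sh k kh; lia.
- apply/sends_aboveP => k; case: (unliftP h k) => [{}k ->|->]; rewrite ?lift_perm_id ?ltnn //.
  by rewrite lift_perm_lift /= /bump => kh; have := sh k; lia.
- have m0 : 0 < m by have := ltn_ord h; lia.
  rewrite -(lift0h (Ordinal m0)) // lift_perm_lift -val_eqE /= /bump.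
  by have := sh (Ordinal m0) h0; lia.
Qed.

Lemma sends_above_enter_leave m (h : 'I_m.+1) (s : 'S_m) :
  let s' := lift_perm ord0 (lift ord0 h) (lift_perm h ord0 s) in
  avoids [:: 3; 2; 1] s' && sends_above s' h.+1
    = avoids [:: 3; 2; 1] s && sends_above s h.
Proof.
move=> s'; apply/andP/andP => [[avs /sends_aboveP sh]|[avs /sends_aboveP sh]]; split.
- exact: avoids321_lift_perm (avoids321_lift_perm avs).
- apply/sends_aboveP => k kh.
  by have := sh (lift ord0 (lift h k)); rewrite !lift_perm_lift /= /bump; lia.
- apply: avoids321_lift_perm0l.
    move=> k /=; case: (unliftP h k) => [{}k ->|->];
      rewrite ?lift_perm_id ?lift_perm_lift /= /bump; last by lia.
    by have := sh k; lia.
  by apply: avoids321_lift_perm0r => // k kh; have := sh k kh; lia.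
- apply/sends_aboveP => k; case: (unliftP ord0 k) => [{}k ->|->]; rewrite ?lift_perm_id //=.
  case: (unliftP h k) => [{}k ->|->];
    rewrite !lift_perm_lift ?lift_perm_id ?lift_perm_lift /= /bump; last by lia.
  by have := sh k; lia.
Qed.

(** By monotonicity the entry at position 0 is the least positive value on positions 0 to [h]. Hence
    value [h] can occur there only at position 0, and a value below [h] only as a 0 at position
    [h]. *)
Lemma sends_above_pass m (h : 'I_m) (s : 'S_m) (z : 'I_m) : 0 < h -> z = 0 :> nat ->
  avoids [:: 3; 2; 1] s ->
  [&& sends_above s h, s z != h & s h != z] = sends_above s h.+1.
Proof.
move=> h0 z0 avs; apply/and3P/sends_aboveP => [[sh zh hz] i ih|sh].
  have sz : h < s z.
    have /sends_aboveP/(_ z) := sh; rewrite z0 => /(_ h0).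
    by move: zh; rewrite -val_eqE /=; lia.
  have [->//|iz] := eqVneq i z.
  apply: leq_ltn_trans (_ : s z < s i); first exact: ltnW.
  apply: (@sends_above_monotone _ s h) => //; first by move: iz; rewrite -val_eqE /=; lia.
  have [|hi] := ltnP i h; first by move/sends_aboveP: sh => /[apply]; lia.
  have -> : i = h by apply: val_inj => /=; lia.
  by move: hz; rewrite -val_eqE /=; lia.
split; first by apply/sends_aboveP => i ih; have := sh i; lia.
  by have := sh z; rewrite -val_eqE /=; lia.
by have := sh h; rewrite -val_eqE /=; lia.
Qed.

Lemma exc_lift_perm m (i j : 'I_m.+1) (s : 'S_m) :
  exc (lift_perm i j s) = (i < j) + \sum_(k < m) (lift i k < lift j (s k)).
Proof.
rewrite excE (bigD1_ord i) //= lift_perm_id; congr (_ + _).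
by apply: eq_bigr => k _; rewrite lift_perm_lift.
Qed.

Lemma fixp_lift_perm m (i j : 'I_m.+1) (s : 'S_m) :
  fixp (lift_perm i j s) = (i == j) + \sum_(k < m) (lift i k == lift j (s k) :> nat).
Proof.
rewrite fixpE (bigD1_ord i) //= lift_perm_id eq_sym; congr (_ + _).
by apply: eq_bigr => k _; rewrite lift_perm_lift eq_sym.
Qed.

(** * Weights and recurrence for 321-avoiding permutations *)

Section Recurrence321.
Variables (R : comNzRingType) (t q r : R).
Local Open Scope ring_scope.

Definition weight321 m (s : 'S_m) : R := t ^+ exc s * q ^+ Defs.inv s * r ^+ fixp s.

Definition sum321 m h : R :=
  \sum_(s : 'S_m | avoids [:: 3; 2; 1]%N s && sends_above s h) weight321 s.

(** The new point is an excedance with the [h] smaller values to its right. An old point keeps its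
    type: its position moves up by one, and its value does too unless it is below [h], in which case
    the point sits at or after [h] and is a strict anti-excedance before and after. *)
Lemma weight321_enter m (h : 'I_m.+1) (s : 'S_m) : (0 < h)%N -> sends_above s h ->
  weight321 (lift_perm ord0 h s) = t * q ^+ h * weight321 s.
Proof.
move=> h0 /sends_aboveP sh; rewrite /weight321 inv_lift_perm0l exc_lift_perm fixp_lift_perm.
rewrite -val_eqE /= h0 [(0 == _)%N]eq_sym (gtn_eqF h0) add0n add1n !exprS exprD.
under [X in t ^+ X]eq_bigr => k _.
  rewrite (_ : (_ < _)%N = (k < s k)%N);
    last by have := sh k; rewrite /bump; lia.
  over.
under [X in r ^+ X]eq_bigr => k _.
  rewrite (_ : (_ == _)%N = (s k == k :> nat));
    last by have := sh k; rewrite /bump; lia.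
  over.
by rewrite -excE -fixpE; ring.
Qed.

Lemma weight321_leave m (h : 'I_m.+1) (s : 'S_m) : (0 < h)%N -> sends_above s h ->
  weight321 (lift_perm h ord0 s) = q ^+ h * weight321 s.
Proof.
move=> h0 /sends_aboveP sh; rewrite /weight321 inv_lift_perm0r exc_lift_perm fixp_lift_perm.
rewrite -val_eqE /= (gtn_eqF h0) !add0n exprD.
under [X in t ^+ X]eq_bigr => k _.
  rewrite (_ : (_ < _)%N = (k < s k)%N);
    last by have := sh k; rewrite /bump; lia.
  over.
under [X in r ^+ X]eq_bigr => k _.
  rewrite (_ : (_ == _)%N = (s k == k :> nat));
    last by have := sh k; rewrite /bump; lia.
  over.
by rewrite -excE -fixpE; ring.
Qed.

(** The exponent is [h] for inserting value 0 at position [h], then [h + 1] for inserting value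
    [h + 1] in front. *)
Lemma weight321_enter_leave m (h : 'I_m.+1) (s : 'S_m) : sends_above s h ->
  weight321 (lift_perm ord0 (lift ord0 h) (lift_perm h ord0 s))
    = t * q ^+ (h.*2).+1 * weight321 s.
Proof.
move=> /sends_aboveP sh; rewrite /weight321 inv_lift_perm0l inv_lift_perm0r.
rewrite exc_lift_perm fixp_lift_perm (bigD1_ord h) //= [X in r ^+ (_ + X)](bigD1_ord h) //=.
rewrite !lift_perm_id /= /bump /=.
under [X in t ^+ (_ + (_ + X))]eq_bigr => k _.
  rewrite lift_perm_lift /= (_ : (_ < _)%N = (k < s k)%N);
    last by have := sh k; rewrite /bump; lia.
  over.
under [X in r ^+ (_ + (_ + X))]eq_bigr => k _.
  rewrite lift_perm_lift /= (_ : (_ == _)%N = (s k == k :> nat));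
    last by have := sh k; rewrite /bump; lia.
  over.
rewrite -excE -fixpE !add0n add1n -!addnn !exprS !exprD; ring.
Qed.

Lemma weight321_fixed m (s : 'S_m) :
  weight321 (lift_perm ord0 ord0 s) = r * weight321 s.
Proof.
rewrite /weight321 inv_lift_perm0l exc_lift_perm fixp_lift_perm eqxx ltnn add0n addn0.
under [X in t ^+ X]eq_bigr => k _ do rewrite !lift0 ltnS.
under [X in r ^+ (_ + X)]eq_bigr => k _ do rewrite !lift0 eqSS eq_sym.
by rewrite -excE -fixpE add1n exprS; ring.
Qed.

Lemma sum321_rec0 m : sum321 m.+1 0 = r * sum321 m 0 + sum321 m.+1 1.
Proof.
rewrite {1}/sum321 (bigID (fun s : 'S_m.+1 => s ord0 == ord0)) /=; congr (_ + _).
  rewrite big_lift_perm mulr_sumr; apply: eq_big => s; last by rewrite weight321_fixed.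
  have E n (u : 'S_n) : sends_above u 0 by apply/sends_aboveP.
  rewrite !E !andbT; apply/idP/idP; first exact: avoids321_lift_perm.
  by apply: avoids321_lift_perm0l.
apply: eq_bigl => s; rewrite -andbA; congr (_ && _).
apply/andP/sends_aboveP => [[_ s0] i|s1].
  by rewrite ltnS leqn0 => /eqP i0; rewrite (_ : i = ord0) ?lt0n //; apply: val_inj.
split; first by apply/sends_aboveP.
by have := s1 ord0 isT; rewrite lt0n.
Qed.

Lemma sum321_rec m h : (h <= m)%N ->
  sum321 m.+2 h.+1 = (1 + t) * q ^+ h.+1 * sum321 m.+1 h.+1 + sum321 m.+2 h.+2
    + t * q ^+ (h.*2).+1 * sum321 m h.
Proof.
move=> hm.
have hP : (h.+1 < m.+2)%N by []; have hP' : (h < m.+1)%N by [].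
pose H : 'I_m.+2 := Ordinal hP; pose H' : 'I_m.+1 := Ordinal hP'.
have HE : lift ord0 H' = H by apply: val_inj.
(* Four cases, by whether [s ord0 = H] and whether [s H = ord0]: both is a down step, exactly one
   gives the two parts of the level weight [1 + t], neither is an up step. *)
rewrite {1}/sum321 (bigID (fun s : 'S_m.+2 => s ord0 == H)) /=.
rewrite (bigID (fun s : 'S_m.+2 => s H == ord0)) /=.
rewrite [X in _ + X](bigID (fun s : 'S_m.+2 => s H == ord0)) /=.
have -> : \sum_(s : 'S_m.+2 | avoids [:: 3; 2; 1]%N s && sends_above s h.+1
   && (s ord0 == H) && (s H == ord0)) weight321 s
   = t * q ^+ (h.*2).+1 * sum321 m h.
  under eq_bigl => s do rewrite andbAC.
  rewrite big_lift_perm.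
  have E s : (lift_perm ord0 H s H == ord0) = (s H' == ord0).
    have := lift_perm_lift ord0 H s H'; rewrite HE => ->.
    by rewrite -!val_eqE /= /bump; lia.
  under eq_bigl => s do rewrite E.
  rewrite big_lift_perm mulr_sumr -HE; apply: eq_big => s.
    exact: (sends_above_enter_leave H').
  by rewrite (sends_above_enter_leave H') => /andP[_] /weight321_enter_leave.
have -> : \sum_(s : 'S_m.+2 | avoids [:: 3; 2; 1]%N s && sends_above s h.+1
   && (s ord0 == H) && (s H != ord0)) weight321 s
   = t * q ^+ h.+1 * sum321 m.+1 h.+1.
  under eq_bigl => s do rewrite andbAC.
  rewrite big_lift_perm mulr_sumr.
  have E s := @sends_above_enter _ H s isT.
  apply: eq_big => s; rewrite -andbA ?E // => /andP[_]; exact: weight321_enter.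
have -> : \sum_(s : 'S_m.+2 | avoids [:: 3; 2; 1]%N s && sends_above s h.+1
   && (s ord0 != H) && (s H == ord0)) weight321 s
   = q ^+ h.+1 * sum321 m.+1 h.+1.
  rewrite big_lift_perm mulr_sumr.
  have E s := @sends_above_leave _ H s isT.
  apply: eq_big => s; rewrite -andbA ?E // => /andP[_]; exact: weight321_leave.
have -> : \sum_(s : 'S_m.+2 | avoids [:: 3; 2; 1]%N s && sends_above s h.+1
   && (s ord0 != H) && (s H != ord0)) weight321 s
   = sum321 m.+2 h.+2.
  apply: eq_bigl => s; rewrite -!andbA; case: (boolP (avoids _ s)) => //= avs.
  exact: (@sends_above_pass _ H s ord0).
by ring.
Qed.

Lemma sum321_diag h : sum321 h h = (h == 0%N)%:R.
Proof.
case: h => [|h].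
  rewrite /sum321 (eq_bigr (fun=> 1)) => [|s _]; last first.
    by rewrite /weight321 excE fixpE invE !big_ord0 !expr0 !mulr1.
  rewrite (eq_bigl xpredT) => [|s]; first by rewrite sumr_const card_Sn.
  by apply/andP; split; [apply/avoids321P => -[] | apply/sends_aboveP => -[]].
rewrite /sum321 big1 // => s /andP[_ /sends_aboveP sh].
by have := sh ((s^-1)%g ord0) (ltn_ord _); rewrite permKV.
Qed.

(** Every case of the recurrence lowers size minus height by one, so this difference is the path
    length. The factor [t ^+ h] stands for the first [h] positions, all excedances. *)
Lemma sum321_motzkin n h : sum321 (n + h) h = t ^+ h * motzkin t q r n h.
Proof.
elim: n h => [|n IHn] h.
  by rewrite sum321_diag; case: h => [|h]; rewrite ?mulr1 ?mulr0.
case: h => [|h].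
  rewrite addn0 sum321_rec0; have := IHn 0%N; rewrite addn0 => ->.
  by have := IHn 1%N; rewrite addn1 => -> /=; ring.
have [IH1 IH2] := (IHn h.+1, IHn h.+2); rewrite !addnS in IH1 IH2.
by rewrite addnS addSn sum321_rec ?leq_addl // IH1 IH2 IHn /= !exprS; ring.
Qed.

End Recurrence321.

(** * 231-avoiding permutations *)

Section Words.
Implicit Types (u v w : seq nat) (M a k : nat).

Fixpoint av231 w : bool :=
  if w is a :: w' then pairwise (fun x y => ~~ ((a < x) && (y < a))) w' && av231 w'
  else true.

(* In the three statistics below the default value of [head] makes the letter
   following the last one compare as an ascent. *)
Fixpoint wdes w : nat :=
  if w is a :: w' then (head a w' < a) + wdes w' else 0.

Fixpoint w31_2 w : nat :=
  if w is a :: w' then count (fun c => head a w' < c < a) w' + w31_2 w' else 0.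

(* [M] is a strict upper bound of the letters already read. *)
Fixpoint wfmax M w : nat :=
  if w is a :: w' then (M <= a < head a.+1 w') + wfmax (maxn M a.+1) w' else 0.

Lemma av231P w : reflect
  (forall i j k, i < j -> j < k -> k < size w ->
     nth 0 w k < nth 0 w i -> nth 0 w i < nth 0 w j -> False) (av231 w).
Proof.
elim: w => [|a w IHw] /=; first by left=> i j k _ _; rewrite ltn0.
apply: (iffP andP) => [[/(pairwiseP 0) aw /IHw avw] i j k|avw].
  case: i => [|i]; case: j => [|j]; case: k => [|k] //=; rewrite !ltnS; last exact: avw.
  by move=> _ jk kw ka aj; have := aw _ _ (ltn_trans jk kw) kw jk; rewrite ka aj.
split; last by apply/IHw => i j k ij jk kw; apply: (avw i.+1 j.+1 k.+1).
apply/(pairwiseP 0) => j k; rewrite !inE => jw kw jk; apply/negP => /andP[aj ka].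
exact: (avw 0 j.+1 k.+1).
Qed.

Lemma wdes_nth w :
  \sum_(0 <= a < (size w).-1) (nth 0 w a.+1 < nth 0 w a : nat) = wdes w.
Proof.
elim: w => [|a [|b w] IHw] /=; first by rewrite big_geq.
  by rewrite ltnn big_geq.
by rewrite big_nat_recl //=; congr (_ + _); apply: IHw.
Qed.

Lemma w31_2_nth w :
  \sum_(0 <= a < size w) \sum_(a.+2 <= b < size w)
     ((nth 0 w a.+1 < nth 0 w b) && (nth 0 w b < nth 0 w a) : nat) = w31_2 w.
Proof.
elim: w => [|x w IHw]; first by rewrite big_geq.
rewrite [size _]/= big_nat_recl //= -IHw; congr (_ + _); last first.
  by apply: eq_bigr => a _; rewrite big_add1.
rewrite big_add1 /=; case: w {IHw} => [|y w] /=; first by rewrite big_geq.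
rewrite ltnn add0n -sum1_count big_add1 /= [RHS]big_mkcond [RHS](big_nth 0) /=.
  by apply: eq_bigr => i _; case: ifP.
Qed.

Lemma wfmax_nth M w :
  \sum_(0 <= a < size w)
     ([&& M <= nth 0 w a, all (fun x => x < nth 0 w a) (take a w)
        & (a == (size w).-1) || (nth 0 w a < nth 0 w a.+1)] : nat) = wfmax M w.
Proof.
elim: w M => [|x w IHw] M; first by rewrite big_geq.
rewrite [size _]/= big_nat_recl //= -IHw; congr (_ + _).
  by case: w {IHw} => [|y w] //=; rewrite ltnSn.
apply: eq_big_nat => i /= iw; rewrite geq_max !andbA; congr (_ && _).
by case: w iw {IHw} => //= y w; rewrite eqSS.
Qed.

Lemma wfmax_below M w : all (ltn^~ M) w -> wfmax M w = 0.
Proof.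
elim: w M => //= a w IHw M /andP[aM wM].
by rewrite leqNgt aM (maxn_idPl aM) IHw.
Qed.

Lemma wfmax_above M w : all (leq M) w -> wfmax M w = wfmax 0 w.
Proof. by case: w => //= a w /andP[Ma _]; rewrite Ma max0n (maxn_idPr (leqW Ma)). Qed.

(** A 231 has its last letter below its first, so none straddles the junction. The same goes for
    31-2 patterns, and the junction itself is an ascent, so the statistics below are additive. *)
Lemma av231_cat u v : allrel ltn u v -> av231 (u ++ v) = av231 u && av231 v.
Proof.
elim: u => //= a u IHu; rewrite allrel_consl => /andP[/allP av uv].
rewrite pairwise_cat IHu // [allrel _ u v](_ : _ = true); last first.
  by apply/allrelP => x y _ /av; rewrite negb_and -!leqNgt => /ltnW->; rewrite orbT.
rewrite [pairwise _ v](_ : _ = true) ?andbT ?andbA //.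
apply/(pairwiseP 0) => i j _ jv _; rewrite negb_and -!leqNgt; apply/orP; right.
exact/ltnW/av/mem_nth.
Qed.

Lemma wdes_cat u v : allrel ltn u v -> wdes (u ++ v) = wdes u + wdes v.
Proof.
elim: u => //= a u IHu; rewrite allrel_consl => /andP[/allP av uv].
rewrite IHu // addnA; congr (_ + _ + _); case: u {IHu uv} => //=.
case: v av => //= x v av; have := av x (mem_head _ _); lia.
Qed.

Lemma w31_2_cat u v : allrel ltn u v -> w31_2 (u ++ v) = w31_2 u + w31_2 v.
Proof.
elim: u => //= a u IHu; rewrite allrel_consl => /andP[/allP av uv].
rewrite IHu // addnA count_cat; congr (_ + _ + _).
rewrite [X in _ + X](_ : _ = 0) ?addn0.
  by case: u {IHu uv}.
apply/eqP; rewrite -leqn0 leqNgt -has_count; apply/hasPn => x /av /=; lia.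
Qed.

Lemma wfmax_cat M u v : all (leq M) v -> allrel ltn u v ->
  wfmax M (u ++ v) = wfmax M u + wfmax 0 v.
Proof.
elim: u M => [|a u IHu] M Mv; first by rewrite /= wfmax_above.
rewrite allrel_consl => /andP[av uv] /=; rewrite IHu //; last first.
  apply/allP => x xv; rewrite /= geq_max; apply/andP.
  by split; [apply: (allP Mv) | apply: (allP av)].
rewrite addnA; congr (_ + _ + _); case: u {IHu uv} => //=.
by case: v av {Mv} => //= x v /andP[-> _]; rewrite ltnSn.
Qed.

Lemma head_addn k a w : head (k + a) (map (addn k) w) = k + head a w.
Proof. by case: w. Qed.

Lemma av231_shift k w : av231 (map (addn k) w) = av231 w.
Proof.
elim: w => //= a w ->; rewrite pairwise_map; congr (_ && _).
by apply: eq_pairwise => x y; rewrite /= !ltn_add2l.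
Qed.

Lemma wdes_shift k w : wdes (map (addn k) w) = wdes w.
Proof. by elim: w => //= a w ->; rewrite head_addn ltn_add2l. Qed.

Lemma w31_2_shift k w : w31_2 (map (addn k) w) = w31_2 w.
Proof.
elim: w => //= a w ->; rewrite head_addn count_map; congr (_ + _).
by apply: eq_count => x; rewrite /= !ltn_add2l.
Qed.

Lemma wfmax_shift k w : wfmax 0 (map (addn k) w) = wfmax 0 w.
Proof.
have E M : wfmax (k + M) (map (addn k) w) = wfmax M w.
  elim: w M => //= a w IHw M; rewrite -addnS head_addn !leq_add2l.
  by rewrite -addn_maxr IHw.
rewrite -(@wfmax_above k); first by rewrite -[X in wfmax X](addn0 k) E.
by apply/allP => _ /mapP[x _ ->]; apply: leq_addr.
Qed.

End Words.

(** * Permutations as words, and splitting at the first letter *)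

Definition word m (s : 'S_m) : seq nat := [seq val (s j) | j <- enum 'I_m].

Lemma size_word m (s : 'S_m) : size (word s) = m.
Proof. by rewrite size_map size_enum_ord. Qed.

Lemma nth_word m (s : 'S_m) (i : 'I_m) : nth 0 (word s) i = s i.
Proof. exact: sv_ord. Qed.

Lemma word_inj m : injective (@word m).
Proof.
by move=> s u e; apply/permP => i; apply: val_inj; rewrite /= -!nth_word e.
Qed.

Lemma perm_words m :
  perm_eq [seq word s | s <- enum 'S_m] (permutations (iota 0 m)).
Proof.
have us : uniq [seq word s | s <- enum 'S_m].
  by rewrite map_inj_uniq ?enum_uniq //; apply: word_inj.
have sub : {subset [seq word s | s <- enum 'S_m] <= permutations (iota 0 m)}.
  move=> _ /mapP[s _ ->]; rewrite mem_permutations -val_enum_ord /word map_comp.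
  apply: perm_map; apply: uniq_perm; rewrite ?enum_uniq //.
    by rewrite map_inj_uniq ?enum_uniq //; apply: perm_inj.
  move=> i; rewrite mem_enum; apply/mapP; exists ((s^-1)%g i); rewrite ?permKV //.
  by rewrite mem_enum.
apply: uniq_perm => //; first exact: permutations_uniq.
case: (uniq_min_size us sub) => //.
by rewrite size_map -cardE card_Sn size_permutations ?iota_uniq // size_iota.
Qed.

Lemma avoids231E m (s : 'S_m) : avoids [:: 2; 3; 1] s = av231 (word s).
Proof.
rewrite /avoids /contains3 /=; apply/idP/av231P => [avs i j k ij jk | avs].
  rewrite size_word => km ki ij'; move/negP: avs; apply.
  have jm := ltn_trans jk km; have im := ltn_trans ij jm.
  apply/existsP; exists (Ordinal im); apply/existsP; exists (Ordinal jm).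
  apply/existsP; exists (Ordinal km); rewrite /= ij jk -!nth_word /=; lia.
apply/negP => /existsP[i /existsP[j /existsP[k /and5P[ij jk]]]].
rewrite eqb_id !eqbF_neg -!leqNgt => sij ki kj; apply: (avs i j k) => //;
  rewrite ?size_word ?nth_word //.
have : s k != s i by apply: contraTneq ij => /perm_inj<-; rewrite -leqNgt ltnW.
by rewrite -val_eqE /=; lia.
Qed.

Definition words231 n : seq (seq nat) := [seq w <- permutations (iota 0 n) | av231 w].

Lemma mem_words231 n w : (w \in words231 n) = av231 w && perm_eq w (iota 0 n).
Proof. by rewrite mem_filter mem_permutations. Qed.

Lemma words231_uniq n : uniq (words231 n).
Proof. by rewrite filter_uniq ?permutations_uniq. Qed.

Lemma big_avoids231 (R : nmodType) m (F : seq nat -> R) :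
  (\sum_(s : 'S_m | avoids [:: 2; 3; 1]%N s) F (word s) = \sum_(w <- words231 m) F w)%R.
Proof.
rewrite big_filter -(perm_big _ (perm_words m)) /= big_map big_enum_cond /=.
by apply: eq_bigl => s; rewrite avoids231E.
Qed.

(* A 231-avoiding word starting with a has all its letters below a before all
   its letters above a. *)
Definition glue a (u v : seq nat) := a :: u ++ map (addn a.+1) v.

Lemma allrel_glue a u v : all (ltn^~ a) u -> allrel ltn (a :: u) (map (addn a.+1) v).
Proof.
move=> /allP ua; apply/allrelP => x y; rewrite inE => /predU1P xa /mapP[z _ ->].
by case: xa => [->|/ua /= xa] /=; lia.
Qed.

Lemma words231_below a u : u \in words231 a -> all (ltn^~ a) u.
Proof.
rewrite mem_words231 => /andP[_ /perm_mem mu]; apply/allP => x.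
by rewrite mu mem_iota.
Qed.

Lemma iota_glue a m : a <= m ->
  iota 0 m.+1 = iota 0 a ++ a :: map (addn a.+1) (iota 0 (m - a)).
Proof.
move=> am; rewrite -iotaDl addn0 (_ : m.+1 = a + (m - a).+1); last by lia.
by rewrite iotaD.
Qed.

Lemma glue_words231 a m u v : a <= m ->
  u \in words231 a -> v \in words231 (m - a) -> glue a u v \in words231 m.+1.
Proof.
move=> am ua va; have ub := words231_below ua.
move: ua va; rewrite !mem_words231 => /andP[avu pu] /andP[avv pv].
apply/andP; split; last first.
  rewrite (iota_glue am) /glue -cat_cons -[in X in perm_eq _ X]cat1s perm_sym catA perm_cat //.
    by rewrite perm_catC /= perm_cons perm_sym.
  by apply: perm_map; rewrite perm_sym.
rewrite /glue -cat_cons av231_cat ?allrel_glue //= av231_shift avu avv !andbT.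
apply/(pairwiseP 0) => i j iu _ _.
rewrite negb_and -leqNgt; apply/orP; left; apply/ltnW.
by move/allP: ub; apply; rewrite mem_nth.
Qed.

(** After a letter above [a], no letter below [a] can follow, or [a] in front of them would complete
    a 231. *)
Lemma pairwise_filter_cat a w :
  pairwise (fun x y => ~~ ((a < x) && (y < a))) w -> a \notin w ->
  w = [seq x <- w | x < a] ++ [seq x <- w | a <= x].
Proof.
elim: w => //= x w IHw /andP[/allP xw /IHw{}IHw]; rewrite inE negb_or => /andP[ax aw].
have [xa|xa] := ltnP x a; first by rewrite cat_cons -IHw.
have {}ax : a < x by rewrite ltn_neqAle ax.
have /all_filterP E : all (leq a) w.
  by apply/allP => y /xw; rewrite ax -leqNgt.
rewrite E (_ : [seq y <- w | y < a] = [::]) //; apply/eqP.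
rewrite -(negbK (_ == _)) -has_filter; apply/hasPn => y /xw; by rewrite ax.
Qed.

Lemma split_words231 m w : w \in words231 m.+1 ->
  exists a u v, [/\ a <= m, u \in words231 a, v \in words231 (m - a) & w = glue a u v].
Proof.
rewrite mem_words231 => /andP[]; case: w => [|a w]; first by move=> _ /perm_size.
move=> avw pw; have /= /andP[aw uw] : uniq (a :: w) by rewrite (perm_uniq pw) iota_uniq.
have mw x : (x \in a :: w) = (x < m.+1) by rewrite (perm_mem pw) mem_iota.
have am : a <= m by rewrite -ltnS -mw mem_head.
move: avw => /= /andP[pairw avw].
pose u := filter (ltn^~ a) w; pose v' := filter (leq a) w.
have Ew : w = u ++ v' by apply: pairwise_filter_cat.
have pu : perm_eq u (iota 0 a).
  apply: uniq_perm; rewrite ?iota_uniq ?filter_uniq // => x.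
  rewrite mem_filter mem_iota /= add0n; case: ltnP => //= xa.
  by have := mw x; rewrite inE (ltn_eqF xa) /= => ->; lia.
pose v := map (subn^~ a.+1) v'.
have Ev : v' = map (addn a.+1) v.
  rewrite -map_comp -[LHS]map_id; apply/eq_in_map => x; rewrite mem_filter /= => /andP[ax xw].
  by rewrite subnKC // ltn_neqAle ax andbT; apply: contraNneq aw => ->.
have pv : perm_eq v (iota 0 (m - a)).
  apply: (perm_map_inj (@addnI a.+1)); rewrite -Ev -iotaDl addn0.
  apply: uniq_perm; rewrite ?iota_uniq ?filter_uniq // => x.
  rewrite mem_filter mem_iota /=.
  have := mw x; rewrite inE; case: eqP => [-> _|xa /= ->]; last by lia.
  by rewrite (negPf aw) andbF; lia.
have uv : allrel ltn u (map (addn a.+1) v).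
  have ub : all (ltn^~ a) u by apply: filter_all.
  by have := allrel_glue v ub; rewrite allrel_consl => /andP[].
exists a, u, v; rewrite /glue -Ev -Ew !mem_words231 pu pv !andbT; split=> //.
  by move: avw; rewrite Ew av231_cat ?Ev => [/andP[]|].
by move: avw; rewrite Ew av231_cat ?Ev ?av231_shift => [/andP[]|].
Qed.

Lemma perm_words231S m :
  perm_eq (words231 m.+1)
    [seq glue a uv.1 uv.2 | a <- iota 0 m.+1,
       uv <- [seq (u, v) | u <- words231 a, v <- words231 (m - a)]].
Proof.
apply: uniq_perm; first exact: words231_uniq.
  apply: allpairs_uniq_dep => [|a _|]; first exact: iota_uniq.
    by apply: allpairs_uniq => [||[? ?] [? ?] _ _ []]; rewrite ?words231_uniq // => -> ->.
  move=> x y /allpairsPdep[a [p [_ /allpairsP[[u v] [ua va -> {p}]] -> {x}]]].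
  move=> /allpairsPdep[a' [p' [_ /allpairsP[[u' v'] [ua' va' -> {p'}]] -> {y}]]] /= [ea].
  move: ua va ua' va' => /= ua va; rewrite -{}ea => ua' va'.
  have sz w : w \in words231 a -> size w = a.
    by rewrite mem_words231 => /andP[_ /perm_size]; rewrite size_iota.
  move/eqP; rewrite eqseq_cat ?sz // => /andP[/eqP-> /eqP].
  by move/(inj_map (@addnI _)) ->.
move=> w; apply/idP/allpairsPdep.
  move=> /split_words231[a [u [v [am ua va ->]]]].
  exists a, (u, v); rewrite mem_iota ltnS am; split=> //.
  by apply/allpairsP; exists (u, v).
move=> [a [p [am /allpairsP[[u v] [ua va ->]] ->]]].
by move: am; rewrite mem_iota ltnS => am; apply: glue_words231.
Qed.

Lemma big_words231S (R : nmodType) m (F : seq nat -> R) :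
  (\sum_(w <- words231 m.+1) F w =
   \sum_(a < m.+1) \sum_(u <- words231 a) \sum_(v <- words231 (m - a)) F (glue a u v))%R.
Proof.
rewrite (perm_big _ (perm_words231S m)) big_allpairs_dep -[iota _ _]/(index_iota 0 m.+1).
by rewrite big_mkord; apply: eq_bigr => a _; rewrite big_allpairs_dep.
Qed.

Lemma desE m (s : 'S_m) : des s = wdes (word s).
Proof. by rewrite -wdes_nth size_word. Qed.

Lemma p31_2E m (s : 'S_m) : p31_2 s = w31_2 (word s).
Proof. by rewrite -w31_2_nth size_word. Qed.

(** A left-to-right maximum exceeds the letter before it, so only the right half of the double
    ascent condition has to be tested. *)
Lemma fmaxE m (s : 'S_m) : fmax s = wfmax 0 (word s).
Proof.
rewrite -wfmax_nth size_word /fmax; apply: eq_big_nat => a /= am; congr (nat_of_bool _).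
have -> : all (ltn^~ (nth 0 (word s) a)) (take a (word s)) = ltr_max s a.
  apply/(all_nthP 0)/forallP => [H b|H b].
    apply/implyP => ba; have := H b; rewrite size_take size_word am => /(_ ba).
    by rewrite nth_take.
  rewrite size_take size_word am => ba; rewrite nth_take //.
  exact: implyP (H (Ordinal (ltn_trans ba am))) ba.
rewrite andbC; case: (boolP (ltr_max s a)) => //= /forallP lmax; rewrite /dasc.
case: a am lmax => //= a am lmax.
by have /implyP/= /(_ (ltnSn _)) -> := lmax (Ordinal (ltnW am)).
Qed.

Lemma count_iota_between h a : count (fun c => h < c < a) (iota 0 a) = a - h.+1.
Proof.
have [ha|ha] := ltnP h a; last first.
  rewrite (eq_in_count (a2 := pred0)) ?count_pred0 => [|x]; last by rewrite mem_iota /=; lia.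
  by lia.
rewrite -{2}(subnKC ha) iotaD count_cat.
rewrite (eq_in_count (a2 := pred0)) ?count_pred0 => [|x]; last first.
  by rewrite mem_iota /=; lia.
rewrite (eq_in_count (a2 := predT)) ?count_predT ?size_iota // => x.
by rewrite mem_iota /=; lia.
Qed.

(** * Convolution recurrences for 231-avoiding words *)

Section Recurrence231.
Variables (R : comNzRingType) (t q : R).
Local Open Scope ring_scope.

Definition weight231 (r : R) w := t ^+ wdes w * q ^+ (wdes w + w31_2 w) * r ^+ wfmax 0 w.

Definition sum231 (r : R) n : R := \sum_(w <- words231 n) weight231 r w.

(* The extra factor q^(n - 1 - head w) accounts for the 31-2 patterns created by
   prepending to w a letter larger than all of w. *)
Definition headed231 n : R :=
  \sum_(w <- words231 n) weight231 1 w * q ^+ (n - (head 0%N w).+1).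

Definition first_block (r : R) a : R := if a is 0 then r else t * q * headed231 a.

(** If [a = 0], the first letter is a record followed by an ascent, hence [r]. Otherwise it starts a
    descent and plays the 3 for the letters of [u] strictly between [head 0 u] and [a]; no letter of
    [u] is a record, whence [weight231 1 u]. *)
Lemma weight231_glue (r : R) a u v : u \in words231 a ->
  weight231 r (glue a u v) =
  (if a is 0 then r else t * q * (weight231 1 u * q ^+ (a - (head 0%N u).+1)))
  * weight231 r v.
Proof.
move=> ua; have ub := words231_below ua; have uv := allrel_glue v ub.
rewrite /weight231 /glue -cat_cons wdes_cat // w31_2_cat // wfmax_cat //; last exact/allP.
rewrite wdes_shift w31_2_shift wfmax_shift /=.
move: ua; rewrite mem_words231 => /andP[_ pu].
rewrite max0n (@wfmax_below a.+1) ?addn0; last first.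
  by apply: sub_all ub => x /= /ltnW.
case: a ub pu uv => [|a] ub pu uv.
  by rewrite (perm_nilP pu) /=; rewrite !add0n add1n exprS; ring.
case: u ub pu {uv} => [|b u] ub pu; first by have := perm_size pu; rewrite size_iota.
have ba : (b < a.+1)%N by apply: (allP ub); rewrite mem_head.
have hd x : head x (b :: u) = b by [].
rewrite !hd (seq.permP pu) count_iota_between ba [(a.+1 < b)%N]ltnNge (ltnW ba).
move: (wdes (b :: u)) (w31_2 (b :: u)) (wfmax 0 (b :: u)) => x y z.
by rewrite expr1n add0n -[nat_of_bool true]/1%N !exprD !expr1; ring.
Qed.

Lemma sum231S (r : R) m :
  sum231 r m.+1 = \sum_(a < m.+1) first_block r a * sum231 r (m - a).
Proof.
rewrite /sum231 big_words231S; apply: eq_bigr => a _.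
rewrite /first_block /headed231.
under eq_big_seq => u ua do under eq_bigr => v _ do rewrite weight231_glue //.
under eq_bigr do rewrite -mulr_sumr.
rewrite -mulr_suml; congr (_ * _); case: (a : nat) => [|a']; last by rewrite mulr_sumr.
by rewrite big_seq1.
Qed.

Lemma headed231S m :
  headed231 m.+1 = \sum_(a < m.+1) first_block 1 a * (q ^+ (m - a) * sum231 1 (m - a)).
Proof.
rewrite /headed231 big_words231S; apply: eq_bigr => a _.
under eq_big_seq => u ua.
  under eq_bigr => v _ do rewrite weight231_glue // [head _ (glue _ _ _)]/= subSS -mulrA
      [weight231 1 v * _]mulrC.
  rewrite -mulr_sumr -mulr_sumr.
  over.
rewrite -mulr_suml; congr (_ * _); rewrite /first_block.
case: (a : nat) => [|a']; last by rewrite mulr_sumr.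
by rewrite big_seq1.
Qed.

Lemma sum231_0 r : sum231 r 0 = 1.
Proof. by rewrite /sum231 big_seq1 /weight231 /= !expr0 !mulr1. Qed.

(** The two claims are proved together because each recurrence convolves [headed231] with
    [sum231]. *)
Lemma sum231_motzkin_aux n :
  (forall k r, (k <= n)%N -> sum231 r k = motzkin t q r k 0) /\
  (forall k, (k < n)%N -> headed231 k.+1 = q ^+ k * motzkin t q (1 + t) k 0).
Proof.
elim: n => [|n [IHF IHG]].
  by split=> [k r|//]; rewrite leqn0 => /eqP->; rewrite sum231_0.
have FE r : sum231 r n.+1 = motzkin t q r n.+1 0.
  rewrite sum231S motzkin0_recl big_ord_recl
    -[nat_of_ord ord0]/0%N [first_block _ _]/= subn0 IHF //; congr (_ + _).
  apply: eq_bigr => i _; rewrite lift0 [first_block _ _]/= IHG // IHF ?leq_subr //.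
  rewrite (_ : (n - i.+1)%N = (n.-1 - i)%N); last by lia.
  by rewrite exprS; ring.
have GE : headed231 n.+1 = q ^+ n * motzkin t q (1 + t) n 0.
  (* Changing [r] from [1] to [1 + t] has difference [t], which is the [t] of the descent after a
     first letter [a > 0]; the unchanged term is [a = 0]. *)
  rewrite headed231S (motzkin_change_r _ _ 1) big_ord_recl
    -[nat_of_ord ord0]/0%N [first_block _ _]/= subn0 IHF // mul1r mulrDr.
  congr (_ + _); rewrite !mulr_sumr; apply: eq_bigr => i _.
  rewrite lift0 [first_block _ _]/= IHG // IHF ?leq_subr //.
  have -> : q ^+ n = q * q ^+ i * q ^+ (n - i.+1) by rewrite -exprS -exprD subnKC.
  rewrite (_ : (n - i.+1)%N = (n.-1 - i)%N); last by lia.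
  by ring.
split=> [k r|k].
  by rewrite leq_eqVlt => /predU1P[-> //|]; rewrite ltnS; apply: IHF.
by rewrite ltnS leq_eqVlt => /predU1P[-> //|]; apply: IHG.
Qed.

Lemma sum231_motzkin r n : sum231 r n = motzkin t q r n 0.
Proof. by have [H _] := sum231_motzkin_aux n; apply: H. Qed.

End Recurrence231.

Lemma sum_avoids231 (R : comNzRingType) (t q r : R) n :
  (\sum_(s : 'S_n | avoids [:: 2; 3; 1]%N s)
     t ^+ des s * q ^+ (des s + p31_2 s) * r ^+ fmax s = motzkin t q r n 0)%R.
Proof.
rewrite -sum231_motzkin /sum231 -big_avoids231; apply: eq_bigr => s _.
by rewrite /weight231 desE p31_2E fmaxE.
Qed.

(** * Reversal and complement *)

Section Symmetries.
Variable m : nat.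
Implicit Types s : 'S_m.

Definition rev_ord_perm : 'S_m := perm (@rev_ord_inj m).
Definition perm_rev s : 'S_m := (rev_ord_perm * s)%g.
Definition perm_compl s : 'S_m := (s * rev_ord_perm)%g.

Lemma perm_revE s i : perm_rev s i = s (rev_ord i).
Proof. by rewrite permM permE. Qed.

Lemma perm_complE s i : perm_compl s i = rev_ord (s i).
Proof. by rewrite permM permE. Qed.

Lemma perm_revK : involutive perm_rev.
Proof. by move=> s; apply/permP => i; rewrite !perm_revE rev_ordK. Qed.

Lemma perm_complK : involutive perm_compl.
Proof. by move=> s; apply/permP => i; rewrite !perm_complE rev_ordK. Qed.

Lemma ltn_permN s (i j : 'I_m) : i != j -> (s j < s i) = ~~ (s i < s j).
Proof. by rewrite -(inj_eq (@perm_inj _ s)) -val_eqE /=; lia. Qed.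

(** Distinct letters make the strict comparisons of the pattern flip under reversal, as those of the
    permutation do. *)
Lemma contains3_rev a b c s : uniq [:: a; b; c] ->
  contains3 [:: a; b; c] s -> contains3 [:: c; b; a] (perm_rev s).
Proof.
move=> u /existsP[i /existsP[j /existsP[k /and5P[ij jk /eqP sij /eqP sik /eqP sjk]]]].
apply/existsP; exists (rev_ord k); apply/existsP; exists (rev_ord j).
apply/existsP; exists (rev_ord i); rewrite !perm_revE !rev_ordK /=.
have E (x y : 'I_m) : x < y -> (s y < s x) = ~~ (s x < s y).
  by move=> xy; rewrite ltn_permN // -val_eqE neq_ltn xy.
rewrite (E _ _ ij) (E _ _ jk) (E _ _ (ltn_trans ij jk)) sij sik sjk /=.
have := ltn_ord k; move: u; rewrite /= !inE; lia.
Qed.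

Lemma contains3_compl a b c a' b' c' s :
  (a' < b') = ~~ (a < b) -> (a' < c') = ~~ (a < c) -> (b' < c') = ~~ (b < c) ->
  contains3 [:: a; b; c] s -> contains3 [:: a'; b'; c'] (perm_compl s).
Proof.
move=> ab ac bc /existsP[i /existsP[j /existsP[k /and5P[ij jk /eqP sij /eqP sik /eqP sjk]]]].
apply/existsP; exists i; apply/existsP; exists j; apply/existsP; exists k.
have E (x y : 'I_m) : x < y -> (rev_ord (s x) < rev_ord (s y)) = ~~ (s x < s y).
  move=> xy; rewrite -ltn_permN; last by rewrite -val_eqE neq_ltn xy.
  by have := ltn_ord (s x); have := ltn_ord (s y); rewrite /=; lia.
rewrite !perm_complE !E ?(ltn_trans ij jk) // sij sik sjk /= ij jk.
by rewrite ab ac bc !eqxx.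
Qed.

Lemma avoids_rev a b c s : uniq [:: a; b; c] ->
  avoids [:: c; b; a] (perm_rev s) = avoids [:: a; b; c] s.
Proof.
move=> u; congr (~~ _); apply/idP/idP; last exact: contains3_rev.
rewrite -{2}(perm_revK s); apply: contains3_rev.
by rewrite -rev_uniq.
Qed.

Lemma avoids_compl a b c a' b' c' s :
  (a' < b') = ~~ (a < b) -> (a' < c') = ~~ (a < c) -> (b' < c') = ~~ (b < c) ->
  avoids [:: a'; b'; c'] (perm_compl s) = avoids [:: a; b; c] s.
Proof.
move=> ab ac bc; congr (~~ _); apply/idP/idP; last exact: contains3_compl.
by rewrite -{2}(perm_complK s); apply: contains3_compl; rewrite ?ab ?ac ?bc negbK.
Qed.

Lemma sv_perm_rev s a : a < m -> sv (perm_rev s) a = sv s (m - a.+1).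
Proof.
move=> am; rewrite -[a]/(val (Ordinal am)) sv_ord perm_revE.
by rewrite -[(m - _.+1)%N]/(val (rev_ord (Ordinal am))) sv_ord.
Qed.

Lemma sv_compl_lt s a b : a < m -> b < m ->
  (sv (perm_compl s) a < sv (perm_compl s) b) = (sv s b < sv s a).
Proof.
move=> am bm; rewrite -[a]/(val (Ordinal am)) -[b]/(val (Ordinal bm)) !sv_ord !perm_complE /=.
have := ltn_ord (s (Ordinal am)); have := ltn_ord (s (Ordinal bm)); lia.
Qed.

Lemma asc_rev s : asc (perm_rev s) = des s.
Proof.
rewrite /asc /des [RHS]big_nat_rev /=; apply: eq_big_nat => a am.
rewrite !sv_perm_rev; try lia.
by congr (nat_of_bool (sv s _ < sv s _)); lia.
Qed.

Lemma p2_13_rev s : p2_13 (perm_rev s) = p31_2 s.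
Proof.
rewrite /p31_2 /p2_13; case: (posnP m) => [m0|m0].
  by rewrite !big_geq //; lia.
have recr (G : nat -> nat) : \sum_(0 <= a < m) G a = \sum_(0 <= a < m.-1) G a + G m.-1.
  by rewrite -{1}(prednK m0) big_nat_recr.
(* The outer index [m.-1] leaves no room for [b]; dropping it makes the two outer ranges equal. *)
rewrite recr [X in _ + X]big_geq ?addn0; last by lia.
rewrite [RHS]big_nat_rev /=; apply: eq_big_nat => a am.
rewrite -[X in _ = \sum_(X <= b < _) _]add0n big_addn [RHS]big_nat_rev.
rewrite (_ : m - _ = a); last lia.
apply: eq_big_nat => b ba; rewrite !sv_perm_rev; try lia.
by congr (nat_of_bool ((sv s _ < sv s _) && (sv s _ < sv s _))); lia.
Qed.

Lemma rtl_max_rev s a : a < m -> rtl_max (perm_rev s) (m - a.+1) = ltr_max s a.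
Proof.
move=> am; have E c : c < m -> m - (m - c.+1).+1 = c by lia.
apply/forallP/forallP => H b; apply/implyP => ba; have bm := ltn_ord b.
  have lt : m - a.+1 < rev_ord b by rewrite /=; lia.
  by move: (implyP (H (rev_ord b)) lt); rewrite !sv_perm_rev ?E //=; lia.
have lt : rev_ord b < a by rewrite /=; lia.
by move: (implyP (H (rev_ord b)) lt); rewrite !sv_perm_rev ?E //; lia.
Qed.

Lemma amax_rev s : amax (perm_rev s) = fmax s.
Proof.
rewrite /amax /fmax big_nat_rev /=; apply: eq_big_nat => a am.
(* Reversal exchanges the left and right neighbours, so the two halves of the condition are swapped
   before being compared. *)
rewrite rtl_max_rev //; congr (nat_of_bool (_ && _)); rewrite /ddes /dasc andbC.
have E1 : (m - a.+1 == m.-1) = (a == 0) by lia.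
have E2 : (m - a.+1 == 0) = (a == m.-1) by lia.
rewrite E1 E2; congr (_ && _).
  have [//|a0] := eqVneq a 0; rewrite !sv_perm_rev /=; try lia.
  by congr (sv s _ < sv s _); lia.
have [//|a0] := eqVneq a m.-1; rewrite !sv_perm_rev /=; try lia.
by congr (sv s _ < sv s _); lia.
Qed.

Lemma asc_compl s : asc (perm_compl s) = des s.
Proof. by apply: eq_big_nat => a am; rewrite sv_compl_lt //; lia. Qed.

Lemma des_compl s : des (perm_compl s) = asc s.
Proof. by apply: eq_big_nat => a am; rewrite sv_compl_lt //; lia. Qed.

Lemma p13_2_compl s : p13_2 (perm_compl s) = p31_2 s.
Proof.
apply: eq_big_nat => a am; apply: eq_big_nat => b bm.
by rewrite !sv_compl_lt 1?andbC //; lia.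
Qed.

Lemma p2_31_compl s : p2_31 (perm_compl s) = p2_13 s.
Proof.
apply: eq_big_nat => a am; apply: eq_big_nat => b bm.
by rewrite !sv_compl_lt 1?andbC //; lia.
Qed.

Lemma fmin_compl s : fmin (perm_compl s) = fmax s.
Proof.
apply: eq_big_nat => a am; congr (nat_of_bool (_ && _)); last first.
  by apply: eq_forallb => b; rewrite sv_compl_lt.
rewrite /ddes /dasc; congr (_ && _).
  by case: eqVneq => //= a0; rewrite sv_compl_lt //; lia.
by case: eqVneq => //= a0; rewrite sv_compl_lt //; lia.
Qed.

Lemma amin_compl s : amin (perm_compl s) = amax s.
Proof.
apply: eq_big_nat => a am; congr (nat_of_bool (_ && _)); last first.
  by apply: eq_forallb => b; rewrite sv_compl_lt.
rewrite /ddes /dasc; congr (_ && _).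
  by case: eqVneq => //= a0; rewrite sv_compl_lt //; lia.
by case: eqVneq => //= a0; rewrite sv_compl_lt //; lia.
Qed.

End Symmetries.

(** * Assembling the five cases and the two identities *)

Local Open Scope ring_scope.

Lemma Npoly_motzkin (R : fieldType) (t q r : R) n :
  Npoly n t q r = motzkin t q r n 0.
Proof.
rewrite -[RHS]mul1r -[1](expr0 t) -sum321_motzkin addn0; apply: eq_bigl => s.
by rewrite [sends_above _ _](introT (sends_aboveP _ _)) ?andbT.
Qed.

Lemma quadruple_motzkin (R : fieldType) (tau : seq nat) (st1 st2 st3 : statistic)
    (t q r : R) n : quadruple tau st1 st2 st3 ->
  \sum_(s : 'S_n | avoids tau s) t ^+ st1 _ s * q ^+ st2 _ s * r ^+ st3 _ s
    = motzkin t q r n 0.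
Proof.
(* Reversal takes 231 to 132. This case comes first because 312 is reached from it by complement,
   while 213 is the complement of 231. *)
have sum132 : \sum_(s : 'S_n | avoids [:: 1; 3; 2]%N s)
     t ^+ asc s * q ^+ (asc s + p2_13 s) * r ^+ amax s = motzkin t q r n 0.
  rewrite (reindex_inj (inv_inj (@perm_revK n))) -sum_avoids231.
  by apply: eq_big => s; rewrite ?avoids_rev // asc_rev p2_13_rev amax_rev.
case=> //.
- exact: Npoly_motzkin.
- exact: sum_avoids231.
- rewrite (reindex_inj (inv_inj (@perm_complK n))) -sum132.
  apply: eq_big => s; first exact: avoids_compl.
  by rewrite des_compl p2_31_compl amin_compl.
- rewrite (reindex_inj (inv_inj (@perm_complK n))) -sum_avoids231.
  apply: eq_big => s; first exact: avoids_compl.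
  by rewrite asc_compl p13_2_compl fmin_compl.
Qed.

Theorem theorem3p12 (R : fieldType) (n : nat) (hn : (0 < n)%N)
  (tau : seq nat) (st1 st2 st3 : statistic) (hq : quadruple tau st1 st2 st3)
  (t q : R) (ht : t != 0) (hq0 : q != 0) :
  Npoly n (t / q) q 1 =
    \sum_(s : 'S_n.-1 | avoids tau s)
       t ^+ st1 _ s * q ^+ st2 _ s * (1 + t) ^+ st3 _ s
  /\
  Npoly n t q t =
    t ^+ n * \sum_(s : 'S_n.-1 | avoids tau s)
       (q / t) ^+ st1 _ s * q ^+ st2 _ s * (1 + q / t) ^+ st3 _ s.
Proof.
rewrite !(quadruple_motzkin _ _ _ _ hq) !Npoly_motzkin.
case: n hn => // n _; split; first by rewrite motzkin_contraction1 // mul1r addr0.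
by have := motzkin_contraction2 q n 0 ht; rewrite !expr0 !mul1r addr0.
Qed.
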